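(* Let $(M,d)$ be a compact metric space, let $\mu$ be a Borel probability measure on $M$, and let $k:M\times M\to[0,\infty)$ satisfy $k(p,q)=k(q,p)$ for all $p,q\in M$, $k(p,p)=0$ for all $p\in M$, and, for some $L>0$, $|k(p,s)-k(q,s)|\le L\,d(p,q)$ for all $p,q,s\in M$. For $b>0$ and Borel measurable $f\ge 0$ with $\int_M f\,d\mu=1$ define $$U[f](p)=\int_M k(p,q)f(q)\,d\mu(q),\qquad \mathcal{E}_b[f]=\int_M\Big\{\log f+\frac b2 U[f]\Big\}f\,d\mu .$$ Let $b_n\to\infty$ and let $g_n\ge 0$ with $\int_M g_n\,d\mu=1$ satisfy $\mathcal{E}_{b_n}[g_n]=\min_{f\ge0,\ \int_M f\,d\mu=1}\mathcal{E}_{b_n}[f]$. Then the sequence of measures $\nu_n=g_n\,d\mu$ has a subsequence that converges weakly to a Borel probability measure $\nu$ supported on a set $A\subseteq M$ such that $k(p,q)=0$ for all $p,q\in A$.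
   Context: The convention $0\log 0=0$ is used in the free energy $\mathcal{E}_b$. *)

(* Defs.v *)
From HB Require Import structures.
From mathcomp Require Import all_boot all_order all_algebra.
From mathcomp Require Import all_classical all_reals all_analysis.
Set Implicit Arguments. Unset Strict Implicit. Unset Printing Implicit Defensive.
Import Order.TTheory GRing.Theory Num.Theory numFieldNormedType.Exports.
Local Open Scope classical_set_scope.
Local Open Scope ring_scope.

Notation borelT M := (g_sigma_algebraType (@open M)).

(* metric spaces with a distinguished point (needed so that the generated
   sigma-algebra structure applies; harmless: a space carrying a probability
   measure is nonempty) *)
#[short(type="pointedMetricType")]
HB.structure Definition PointedMetric (K : numDomainType) :=
  { M of Metric K M & isPointed M }.

Definition xlogx {R : realType} (x : R) : R := if x == 0 then 0 else x * ln x.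

Section energy.
Context {R : realType} {M : ptopologicalType}.
Variables (mu : {measure set (borelT M) -> \bar R}) (k : M -> M -> R).

Definition admissible (f : M -> R) : Prop :=
  [/\ measurable_fun (setT : set (borelT M)) f,
      (forall x, 0 <= f x) &
      (\int[mu]_x (f x)%:E = 1)%E].

Definition Upot (f : M -> R) (p : M) : \bar R :=
  (\int[mu]_q (k p q * f q)%:E)%E.

Definition Eb (b : R) (f : M -> R) : \bar R :=
  (\int[mu]_p ((xlogx (f p))%:E + (b / 2 * f p)%:E * Upot f p))%E.
End energy.

(* Main.v *)
(** A weak limit of the measures [nu_n = g_n dmu] is produced without extracting
    a diagonal subsequence: along an ultrafilter the masses [nu_n K] of closed
    sets converge to a content, and Halmos' construction turns this content into
    a Borel probability [nu] with [nu O <= lim nu_n O] for all open [O].  Second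
    countability then yields a genuine subsequence with [nu O <= liminf nu_n O]
    for all open [O], and slicing continuous functions into layers gives weak
    convergence.

    For the support, compare [g_n] with the normalised indicator of a small ball
    [B] of positive measure: since [k] vanishes on the diagonal and is Lipschitz,
    its energy is at most [- ln (mu B) + b_n * eps], whereas [x ln x >= -1] gives
    [E_b[g_n] >= -1 + b_n / 2 * c * nu_n A * nu_n A'] whenever [k >= c] on
    [A * A'].  Hence [nu_n A * nu_n A'] tends to zero, so two balls on which [k]
    stays away from zero cannot both have positive [nu]-mass. *)

Require Import Defs.
From HB Require Import structures.
From mathcomp Require Import all_boot all_order all_algebra.
From mathcomp Require Import ring lra.
From mathcomp Require Import all_classical all_reals all_analysis.
From mathcomp Require Import measurable_realfun.
Set Implicit Arguments.
Unset Strict Implicit.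
Unset Printing Implicit Defensive.
Import Order.TTheory GRing.Theory Num.Theory numFieldNormedType.Exports.
Local Open Scope classical_set_scope.
Local Open Scope ring_scope.

(** Normality separates the disjoint closed sets [K] minus [U] and [K] minus [V] by open sets [W1]
    and [W2]; removing [W1], respectively [W2], from [K] leaves the two pieces. Subadditivity of the
    inner content rests on this. *)
Lemma closed_split (R : realType) (T : topologicalType) (K U V : set T) :
  normal_space T -> closed K -> open U -> open V -> K `<=` U `|` V ->
  exists K1 K2, [/\ closed K1, closed K2, K1 `<=` U, K2 `<=` V &
    K = K1 `|` K2].
Proof.
move=> nT cK oU oV KUV.
have cl W : open W -> closed (K `&` ~` W).
  by move=> oW; apply: closedI => //; exact: open_closedC.
have [|W1 [W2 [ oW1 oW2 sW1 sW2 W12]]] :=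
    (@normal_openP R T).1 nT _ _ (cl _ oU) (cl _ oV).
  by rewrite -subset0 => x [[Kx nU] [_ nV]]; case: (KUV x Kx).
exists (K `&` ~` W1), (K `&` ~` W2); split; [exact: cl | exact: cl | | | ].
- by move=> x [Kx nW]; apply: contrapT => nUx; apply: nW; exact: sW1.
- by move=> x [Kx nW]; apply: contrapT => nUx; apply: nW; exact: sW2.
- by rewrite -setIUr -setCI W12 setC0 setIT.
Qed.

(** * Borel measures from contents on a compact Hausdorff space *)

Section content_extension.
Context {R : realType} {T : ptopologicalType}.
Variable lam : set T -> R.
Hypothesis lam0 : lam set0 = 0.
Hypothesis lam_le : forall A B, closed A -> closed B -> A `<=` B ->
  lam A <= lam B.
Hypothesis lamU_le : forall A B, closed A -> closed B ->
  lam (A `|` B) <= lam A + lam B.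
Hypothesis lamU : forall A B, closed A -> closed B -> A `&` B = set0 ->
  lam (A `|` B) = lam A + lam B.
Hypothesis hT : hausdorff_space T.
Hypothesis cT : compact [set: T].

(** Halmos' two-step extension: closed sets, which are compact here, approximate open sets from
    inside, and open sets then approximate arbitrary sets from outside. Only the values of [lam] on
    closed sets matter. *)
Definition inner_content (O : set T) : \bar R :=
  ereal_sup [set (lam K)%:E | K in [set K | closed K /\ K `<=` O]].

Definition outer_content (A : set T) : \bar R :=
  ereal_inf [set inner_content O | O in [set O | open O /\ A `<=` O]].

Local Open Scope ereal_scope.

Lemma le_inner_content K O : closed K -> K `<=` O ->
  (lam K)%:E <= inner_content O.
Proof. by move=> cK KO; apply: ereal_sup_ubound; exists K. Qed.

Lemma inner_content_ge0 O : 0 <= inner_content O.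
Proof. by rewrite -[0]/(0%:E) -lam0; apply: le_inner_content => //; exact: closed0. Qed.

Lemma inner_contentS O O' : O `<=` O' -> inner_content O <= inner_content O'.
Proof.
move=> OO'; apply: ge_ereal_sup => _ [K [cK KO] <-].
by apply: le_inner_content => //; exact: subset_trans OO'.
Qed.

Lemma inner_content_leT O : inner_content O <= (lam setT)%:E.
Proof.
apply: ge_ereal_sup => _ [K [cK KO] <-]; rewrite lee_fin.
by apply: lam_le => //; exact: closedT.
Qed.

Lemma inner_content_fin_num O : inner_content O \is a fin_num.
Proof.
by rewrite ge0_fin_numE ?inner_content_ge0// (le_lt_trans (inner_content_leT O))// ltry.
Qed.

(** Induction on [n]: [closed_split] cuts [K] into a closed part covered by the first [n] open sets
    and a closed part inside the last one. *)
Lemma le_sum_inner_content n K (O : (set T)^nat) : closed K ->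
  (forall i, open (O i)) -> K `<=` \big[setU/set0]_(i < n) O i ->
  (lam K)%:E <= \sum_(i < n) inner_content (O i).
Proof.
elim: n K => [|n IH] K cK oO.
  by rewrite !big_ord0 subset0 => ->; rewrite lam0.
rewrite !big_ord_recr/= => KO.
have nT : normal_space T by exact: compact_normal.
have [||K1 [K2 [cK1 cK2 K1U K2V ->]]] := closed_split R nT cK _ _ KO.
- by rewrite -bigcup_mkord; apply: bigcup_open => i _; exact: oO.
- exact: oO.
apply: (@le_trans _ _ (lam K1 + lam K2)%:E); first by rewrite lee_fin lamU_le.
by rewrite EFinD leeD// ?IH//; exact: le_inner_content.
Qed.

Lemma inner_content_sigma_subadditive (O : (set T)^nat) :
  (forall i, open (O i)) ->
  inner_content (\bigcup_n O n) <= \sum_(n <oo) inner_content (O n).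
Proof.
move=> oO; apply: ge_ereal_sup => _ [K [cK KO] <-].
have : compact K by exact: subclosed_compact cT _.
rewrite compact_cover => /(_ nat setT O (fun i _ => oO i) KO)[D _ KD].
(* The finite subcover [D] is an arbitrary set of indices; [n] exceeds all of them, so an initial
   segment covers [K]. *)
pose n := (\max_(i <- finmap.enum_fset D) i.+1)%N.
have KOn : K `<=` \big[setU/set0]_(i < n) O i.
  move=> x /KD[i /= iD Oix]; rewrite -bigcup_mkord; exists i => //=.
  by rewrite /n (big_rem i)//= leq_max leqnn.
apply: le_trans (le_sum_inner_content cK oO KOn) _.
rewrite -(big_mkord xpredT (inner_content \o O)).
by apply: nneseries_lim_ge => i _ _; exact: inner_content_ge0.
Qed.

Lemma outer_content_le O A : open O -> A `<=` O ->
  outer_content A <= inner_content O.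
Proof. by move=> oO AO; apply: ereal_inf_lbound; exists O. Qed.

Lemma outer_content_open O : open O -> outer_content O = inner_content O.
Proof.
move=> oO; apply/eqP; rewrite eq_le outer_content_le//=.
by apply: le_ereal_inf_tmp => _ [ O' [ oO' OO'] <-]; exact: inner_contentS.
Qed.

Lemma outer_content_ge0 A : 0 <= outer_content A.
Proof. by apply: le_ereal_inf_tmp => _ [ O' _ <-]; exact: inner_content_ge0. Qed.

Lemma outer_content_fin_num A : outer_content A \is a fin_num.
Proof.
rewrite ge0_fin_numE ?outer_content_ge0//.
apply: (@le_lt_trans _ _ (inner_content setT)).
  by apply: outer_content_le => //; exact: openT.
by rewrite (le_lt_trans (inner_content_leT _))// ltry.
Qed.

Lemma outer_contentS A B : A `<=` B -> outer_content A <= outer_content B.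
Proof.
move=> AB; apply: le_ereal_inf_tmp => _ [ O [ oO BO] <-].
by apply: outer_content_le => //; exact: subset_trans BO.
Qed.

Lemma outer_content0 : outer_content set0 = 0.
Proof.
rewrite outer_content_open; last exact: open0.
apply/eqP; rewrite eq_le inner_content_ge0 andbT.
by apply: ge_ereal_sup => _ [K [_ +] <-]; rewrite subset0 => ->; rewrite lam0.
Qed.

Lemma outer_content_adherent A (e : R) : (0 < e)%R ->
  exists O, [/\ open O, A `<=` O & inner_content O <= outer_content A + e%:E].
Proof.
move=> e0; have [_ [ O [ oO AO] <-]] :=
  lb_ereal_inf_adherent e0 (outer_content_fin_num A).
by move=> /ltW h; exists O.
Qed.

Lemma outer_content_sigma_subadditive : sigma_subadditive outer_content.
Proof.
move=> A; apply/lee_addgt0Pr => e e0.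
(* Each [A i] is enclosed in an open set with excess [e / 2 ^ (i + 1)]; these excesses sum to
   [e]. *)
have ei i : (0 < e / (2 ^ i.+1)%:R :> R)%R by rewrite divr_gt0// ltr0n expn_gt0.
have /choice[ O hO] i := outer_content_adherent (A i) (ei i).
have oO i : open (O i) by have [] := hO i.
apply: (@le_trans _ _ (inner_content (\bigcup_n O n))).
  apply: outer_content_le; first exact: bigcup_open.
  by apply: subset_bigcup => i _; have [] := hO i.
apply: le_trans (inner_content_sigma_subadditive oO) _.
apply: le_trans (epsilon_trick xpredT _ (ltW e0)); last first.
  by move=> n; exact: outer_content_ge0.
apply: lee_nneseries => i _; first by move=> _; exact: inner_content_ge0.
by have [] := hO i.
Qed.

(** Take an open [V] around [X], then a nearly optimal closed [K] inside [V] and [U], then a nearly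
    optimal closed [K'] in [V] minus [K]. Removing [K] instead of [U] keeps the set open; [K] and
    [K'] are disjoint inside [V], so additivity of [lam] applies. Each choice costs [e / 3]. *)
Lemma outer_content_caratheodory (U : set T) : open U ->
  forall X, outer_content (X `&` U) + outer_content (X `&` ~` U)
            <= outer_content X.
Proof.
move=> oU X; apply/lee_addgt0Pr => e e0.
have e30 : (0 < e / 3)%R by rewrite divr_gt0.
have [V [ oV XV Vle]] := outer_content_adherent X e30.
have [_ [K [cK KVU] <-] lK] :=
  ub_ereal_sup_adherent e30 (inner_content_fin_num (V `&` U)).
have oVK : open (V `&` ~` K) by apply: openI => //; exact: closed_openC.
have [_ [K' [cK' K'V] <-] lK'] :=
  ub_ereal_sup_adherent e30 (inner_content_fin_num (V `&` ~` K)).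
rewrite -/(inner_content _) in lK lK'.
have h1 : outer_content (X `&` U) <= (lam K + e / 3)%:E.
  rewrite EFinD; apply: (@le_trans _ _ (inner_content (V `&` U))).
    by apply: outer_content_le; [exact: openI|exact: setSI].
  by rewrite -leeBlDr// ltW.
have h2 : outer_content (X `&` ~` U) <= (lam K' + e / 3)%:E.
  rewrite EFinD; apply: (@le_trans _ _ (inner_content (V `&` ~` K))).
    apply: outer_content_le => // x [Xx nUx]; split; first exact: XV.
    by move=> /KVU[].
  by rewrite -leeBlDr// ltW.
have h3 : (lam K + lam K')%:E <= outer_content X + (e / 3)%:E.
  apply: le_trans Vle; rewrite -lamU//; last first.
    by rewrite -subset0 => x [Kx /K'V[]].
  apply: le_inner_content; first exact: closedU.
  by move=> x [/KVU[]|/K'V[]].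
apply: le_trans (leeD h1 h2) _.
move: h3; rewrite -(fineK (outer_content_fin_num X)) -!EFinD !lee_fin => h3.
by lra.
Qed.

(** Open sets are Carathéodory measurable for the outer content, hence so are all Borel sets, and on
    these the outer content is a measure. *)
Lemma content_measure : exists nu : {measure set (borelT T) -> \bar R},
  forall O : set T, open O -> nu O = inner_content O.
Proof.
pose om : {outer_measure set T -> \bar R} := HB.pack outer_content
  (isOuterMeasure.Build R T outer_content
    outer_content0 outer_content_ge0 outer_contentS
    outer_content_sigma_subadditive).
have borel_cara (A : set T) : <<s @open T >> A -> om.-caratheodory A.
  apply: smallest_sub.
    split; first exact: caratheodory_measurable_set0.
    - by move=> B mB; rewrite setTD; exact: caratheodory_measurable_setC.
    - exact: caratheodory_measurable_bigcup.
  move=> B oB; apply: le_caratheodory_measurable.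
  exact: outer_content_caratheodory.
have sadd : semi_sigma_additive (outer_content : set (borelT T) -> \bar R).
  move=> F mF tF mUF; apply: (@caratheodory_measure_sigma_additive R T om) => //.
  - by move=> i; exact: borel_cara (mF i).
  - exact: borel_cara mUF.
pose m := isMeasure.Build _ (borelT T) R outer_content
  outer_content0 outer_content_ge0 sadd.
pose nu : {measure set (borelT T) -> \bar R} :=
  HB.pack (outer_content : set (borelT T) -> \bar R) m.
by exists nu => O oO; exact: outer_content_open.
Qed.

End content_extension.

Lemma measure_probability d (T : measurableType d) (R : realType)
    (nu : {measure set T -> \bar R}) : nu setT = 1%E ->
  exists P : probability T R, forall A, P A = nu A.
Proof.
case: nu => f f_measure nuT.
pose nu : {measure set T -> \bar R} := Measure.Pack f_measure.
pose P : probability T R :=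
  HB.pack f (Measure_isProbability.Build _ _ _ nu nuT) nu.
by exists P.
Qed.

(** * Limits of probability measures *)

(** The image of [U] contains a compact segment, hence clusters at some [p]. An ultrafilter contains
    the preimage of a neighbourhood or that of its complement, and clustering at [p] excludes the
    latter. *)
Lemma ultra_bounded_cvg (R : realType) (I : Type) (U : set_system I)
    (f : I -> R) (a b : R) :
  UltraFilter U -> (forall i, a <= f i <= b) -> cvg (f @ U).
Proof.
move=> UU fab.
have /(@segment_compact R a b)[] : (f @ U) `[a, b]%classic.
  by apply: (@filterE _ U) => i; rewrite /= in_itv/=.
move=> p [_ clp]; apply/cvg_ex; exists p => B /= Bp.
have [//|nB] := in_ultra_setVsetC (f @^-1` B) UU.
by have [x [nBx Bx]] := clp (~` B) B nB Bp.
Qed.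

(** Limits along [U] of the masses of closed sets inherit monotonicity, subadditivity, disjoint
    additivity and total mass one, so they form a content to which [content_measure] applies. *)
Lemma limit_measure_of_ultrafilter (R : realType) (T : ptopologicalType)
    (P : nat -> probability (borelT T) R) (U : set_system nat) :
  hausdorff_space T -> compact [set: T] -> UltraFilter U ->
  exists nu : probability (borelT T) R, forall O : set T, open O ->
    forall e : R, 0 < e -> \forall n \near U, (nu O <= P n O + e%:E)%E.
Proof.
move=> hT cT UU; pose p A n := fine (P n A).
have mO (A : set T) : open A -> measurable (A : set (borelT T)).
  by move=> oA; exact: sub_sigma_algebra.
have mC (A : set T) : closed A -> measurable (A : set (borelT T)).
  by move=> cA; rewrite -[A]setCK; apply: measurableC; exact: mO (closed_openC cA).
have pE (A : set (borelT T)) n : measurable A -> P n A = (p A n)%:E.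
  by move=> mA; rewrite fineK// fin_num_measure.
have p01 (A : set (borelT T)) : measurable A -> forall n, 0 <= p A n <= 1.
  by move=> mA n; rewrite -!lee_fin -pE// measure_ge0 probability_le1.
have pcvg A : closed A -> cvg (p A @ U).
  by move=> cA; apply: ultra_bounded_cvg (p01 _ (mC _ cA)).
pose lam (A : set T) := lim (p A @ U).
have lim_le (A : set T) (f : nat -> R) : closed A -> cvg (f @ U) ->
    (forall n, p A n <= f n) -> lam A <= lim (f @ U).
  by move=> cA cf Af; apply: ler_lim => //; [exact: pcvg|exact: filterE].
have lamU_le A B : closed A -> closed B -> lam (A `|` B) <= lam A + lam B.
  move=> cA cB; rewrite /lam -limD; [|exact: pcvg..].
  apply: lim_le; [exact: closedU|apply: is_cvgD; exact: pcvg|] => n.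
  rewrite -lee_fin EFinD -!pE; try exact: mC; last exact: (mC _ (closedU cA cB)).
  by apply: measureU2; exact: mC.
have lamU A B : closed A -> closed B -> A `&` B = set0 ->
    lam (A `|` B) = lam A + lam B.
  move=> cA cB AB; rewrite /lam -limD; [|exact: pcvg..].
  congr (lim (_ @ U)); apply/funext => n; apply: EFin_inj.
  rewrite EFinD -!pE; try exact: mC; last exact: (mC _ (closedU cA cB)).
  by apply: measureU => //; exact: mC.
have lamT : lam setT = 1.
  rewrite /lam (_ : p setT = cst 1) ?lim_cst//.
  by apply/funext => n; rewrite /p probability_setT.
have lam0 : lam set0 = 0.
  rewrite /lam (_ : p set0 = cst 0) ?lim_cst//.
  by apply/funext => n; rewrite /p measure0.
have lam_le A B : closed A -> closed B -> A `<=` B -> lam A <= lam B.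
  move=> cA cB AB; apply: lim_le => //; first exact: pcvg.
  by move=> n; rewrite -lee_fin -!pE ?le_measure ?inE//; exact: mC.
have [nu nuE] := content_measure lam0 lam_le lamU_le lamU hT cT.
have nuT : nu setT = 1%E.
  rewrite nuE; last exact: openT.
  apply/eqP; rewrite eq_le -[1%E]/(1%:E) -lamT inner_content_leT//=.
  by apply: le_inner_content => //; exact: closedT.
have [nuP nuPE] := measure_probability nuT.
exists nuP => O oO e e0.
rewrite nuPE nuE//.
(* Half of [e] pays for replacing [O] by a closed [K] inside it, the other half for replacing
   [lam K] by the mass [p K n]. *)
have e20 : 0 < e / 2 by rewrite divr_gt0.
have [_ [K [cK KO] <-]] :=
  ub_ereal_sup_adherent e20 (inner_content_fin_num lam0 lam_le O).
rewrite -/(inner_content lam O) => /ltW lK.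
have : \forall n \near U, lam K - e / 2 <= p K n.
  by apply: (cvgr_ge _ (pcvg _ cK)); rewrite ltrBlDr ltrDl.
move=> Un; apply: (filterS _ Un) => n pn; rewrite -leeBlDr//.
apply: (@le_trans _ _ (P n K)); last first.
  by apply: le_measure; rewrite ?inE//; [exact: mC|exact: mO].
rewrite pE; last exact: mC.
move: lK pn; rewrite -(fineK (inner_content_fin_num lam0 lam_le O)).
by rewrite -!EFinB !lee_fin; lra.
Qed.

(** * Countable bases and the extraction of a genuine subsequence *)

Lemma second_countable_open_cover (T : topologicalType) :
  @second_countable T -> exists2 W : nat -> set T,
    (forall i, open (W i)) &
    (forall O, open O -> O = \bigcup_(i in [set i | W i `<=` O]) W i).
Proof.
move=> [B /countable_injP[f finj] [oB bB]].
(* Since [f] is injective on [B], this union is the basic set with code [i], or empty when no basic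
   set has that code. *)
exists (fun i => \bigcup_(V in [set V | B V /\ f V = i]) V).
  by move=> i; apply: bigcup_open => V [/oB].
move=> O oO; apply/seteqP; split=> [x Ox|x [i iO Vx]]; last exact: iO.
have [V [BV Vx] VO] := bB x O (open_nbhs_nbhs (conj oO Ox)).
have WV : \bigcup_(V' in [set V' | B V' /\ f V' = f V]) V' = V.
  apply/seteqP; split=> [y [V' [BV' /finj]]|y Vy]; last by exists V.
  by rewrite !inE => /(_ BV' BV) ->.
by exists (f V) => //=; rewrite WV.
Qed.

(** There are only countably many finite unions of basic sets. Stage [n] of the subsequence treats
    those with code at most [n], with error [1 / (n + 1)]; an arbitrary open set is then exhausted
    from inside by such unions. *)
Lemma open_liminf_subsequence (R : realType) (T : ptopologicalType)
    (P : nat -> probability (borelT T) R) :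
  hausdorff_space T -> compact [set: T] -> @second_countable T ->
  exists (phi : nat -> nat) (nu : probability (borelT T) R),
    {homo phi : m n / (m < n)%N >-> (m < n)%N} /\
    forall O : set T, open O -> forall e : R, 0 < e ->
      \forall n \near \oo, (nu O <= P (phi n) O + e%:E)%E.
Proof.
move=> hT cT /second_countable_open_cover[W oW WE].
have [U [UU ooU]] := ultraFilterLemma (F := \oo) _.
have [nu nuU] := limit_measure_of_ultrafilter P hT cT UU.
have mO (A : set T) : open A -> measurable (A : set (borelT T)).
  by move=> oA; exact: sub_sigma_algebra.
pose V (s : seq nat) : set T := \bigcup_(i in [set` s]) W i.
have oV s : open (V s) by apply: bigcup_open => i _; exact: oW.
(* Numbers that code no list are sent to the empty list, hence to the empty set, where the bound is
   harmless. *)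
pose Vn j := V (odflt [::] (unpickle j)).
(* The good indices for finitely many open sets form a member of [U], and so does each tail because
   [U] refines [\oo]; their intersection is nonempty. The pair [nN] holds the stage and the index to
   be exceeded. *)
have next nN : exists m, (nN.2 < m)%N /\ forall j : 'I_nN.1.+1,
    (nu (Vn j) <= P m (Vn j) + (nN.1.+1%:R^-1)%:E)%E.
  case: nN => n N /=.
  have n0 : 0 < n.+1%:R^-1 :> R by [].
  have UV : U [set m | forall j : 'I_n.+1,
      (nu (Vn j) <= P m (Vn j) + (n.+1%:R^-1)%:E)%E].
    by apply: filter_forall => j; exact: (nuU (Vn j) (oV _) _ n0).
  by have [m []] := filter_ex (filterI (ooU _ (nbhs_infty_gt N)) UV); exists m.
have /choice[psi psiP] := next.
pose phi := fix phi n := if n is n'.+1 then psi (n, phi n') else psi (0%N, 0%N).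
have phi_mono : {homo phi : m n / (m < n)%N >-> (m < n)%N}.
  by apply: homo_ltn => [y x z|i]; [exact: ltn_trans|exact: (psiP (_, _)).1].
have phiP n j : (j <= n)%N ->
    (nu (Vn j) <= P (phi n) (Vn j) + (n.+1%:R^-1)%:E)%E.
  move=> jn; case: n jn => [|n] jn.
    exact: ((psiP (0%N, 0%N)).2 (Ordinal (jn : (j < 1)%N))).
  exact: ((psiP (n.+1, phi n)).2 (Ordinal (jn : (j < n.+2)%N))).
exists phi, nu; split=> // O oO e e0.
(* The unions [V (s j)] of the basic sets inside [O] with index below [j] increase to [O]. *)
pose s j := [seq i <- iota 0 j | `[< W i `<=` O >]].
have VsE j x : V (s j) x <-> exists i, [/\ (i < j)%N, W i `<=` O & W i x].
  split=> [[i /=]|[i [ij iO Wix]]].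
    by rewrite mem_filter mem_iota => /andP[/asboolP iO] ij Wix; exists i.
  exists i => //=; rewrite mem_filter mem_iota add0n ij !andbT.
  exact/asboolP.
have VsO j : V (s j) `<=` O by move=> x /VsE[i [_ iO /iO]].
have UV : \bigcup_j V (s j) = O.
  apply/seteqP; split=> [x [j _ /VsO]//|x].
  by rewrite {1}(WE _ oO) => -[i iO Wix]; exists i.+1 => //; apply/VsE; exists i.
have cV : (nu \o (V \o s)) @ \oo --> nu O.
  rewrite -[in X in _ --> X]UV; apply: nondecreasing_cvg_mu.
  - by move=> i; exact: mO (oV (s i)).
  - by rewrite UV; exact: mO oO.
  - move=> i j ij; apply/subsetPset => x /VsE[l [li lO Wlx]].
    by apply/VsE; exists l; split => //; exact: leq_trans ij.
have e20 : 0 < e / 2 by rewrite divr_gt0.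
(* Continuity from below and finiteness of [nu O]: otherwise the limit would give
   [nu O <= nu O - e / 2]. *)
have [j jP] : exists j, (nu O <= nu (V (s j)) + (e / 2)%:E)%E.
  apply: contrapT => /forallNP nj.
  have : (nu O <= nu O - (e / 2)%:E)%E.
    apply: (cvge_le _ cV); apply: nearW => i.
    by rewrite leeBrDr// ltW// ltNge; apply/negP; exact: (nj i).
  rewrite leNgt lteBlDr// lteDl// ?lte_fin ?e20//.
  by apply: fin_num_measure; exact: mO oO.
near=> n.
have jn : (pickle (s j) <= n)%N by near: n; exact: nbhs_infty_ge.
have /ltW n2 : n.+1%:R^-1 < e / 2.
  by near: n; exact: (near_infty_natSinv_lt (PosNum e20)).
have := phiP n _ jn; rewrite /Vn pickleK/= => h.
have -> : e%:E = ((e / 2)%:E + (e / 2)%:E)%E by rewrite -EFinD -splitr.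
rewrite addeA; apply: (le_trans jP); apply: leeD2r.
apply: (le_trans h); apply: leeD; last by rewrite lee_fin.
by apply: le_measure; rewrite ?inE//; [exact: mO (oV _)|exact: mO oO].
Unshelve. all: by end_near. Qed.

(** * Continuous functions, their open superlevel sets and layer sums *)

Lemma continuous_borel_measurable (R : realType) (T : ptopologicalType)
    (h : T -> R) :
  continuous h -> measurable_fun (setT : set (borelT T)) h.
Proof.
move=> /continuousP ch; apply: (measurability _ (RGenOpens.measurableE R)) => //.
move=> _ [_ [a [b ->] <-]]; rewrite setTI; apply: sub_sigma_algebra.
by apply: ch; exact: interval_open.
Qed.

Lemma open_superlevel (R : realType) (T : topologicalType) (h : T -> R) (a : R) :
  continuous h -> open [set x | a < h x].
Proof.
move=> /continuousP ch; have oa : open [set y : R | a < y] by exact: open_gt.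
exact: (ch _ oa).
Qed.

(** The sum counts the grid levels [d * i] strictly below [y], so the middle term is [y] rounded up
    to a multiple of [d]. Strictness makes the layers of a continuous function open. *)
Lemma layer_sum_bounds (R : realType) (m : nat) (d y : R) :
  0 <= d -> 0 <= y <= d * m%:R ->
  y <= d * \sum_(i < m) (d * i%:R < y)%R%:R <= y + d.
Proof.
move=> d0; elim: m => [|m IH].
  rewrite mulr0 -eq_le => /eqP <-.
  by rewrite big_ord0 mulr0 lexx add0r.
move=> /andP[y0 ym].
(* Either the top level contributes nothing and induction applies, or [y] exceeds every level and
   all [m + 1] terms equal one. *)
have [ymd|ymd] := leP y (d * m%:R).
  by rewrite big_ord_recr/= (ltNge _ y) ymd addr0 IH// y0.
rewrite (eq_bigr (fun=> 1)) => [|i _]; last first.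
  have id : d * i%:R <= d * m%:R by rewrite ler_wpM2l// ler_nat -ltnS.
  by rewrite (le_lt_trans id ymd).
rewrite sumr_const card_ord ym /=.
by rewrite -natr1 mulrDr mulr1 lerD2r ltW.
Qed.

Lemma integral_cst_probability d (T : measurableType d) (R : realType)
    (Q : probability T R) (c : R) : (\int[Q]_x c%:E = c%:E)%E.
Proof. by rewrite integral_cst//= probability_setT mule1. Qed.

Section layers.
Context {R : realType} {T : ptopologicalType}.

Lemma bounded_continuous_integrable (Q : probability (borelT T) R)
    (h : T -> R) (C : R) : continuous h -> (forall x, `|h x| <= C) ->
  Q.-integrable [set: borelT T] (EFin \o h).
Proof.
move=> ch hC; apply: measurable_bounded_integrable; first exact: measurableT.
- by rewrite (le_lt_trans (probability_le1 Q measurableT))// ltry.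
- exact: continuous_borel_measurable.
- by exists C; split; [exact: num_real|move=> D CD x _; exact: le_trans (hC x) (ltW CD)].
Qed.

Lemma measurable_layer (h : T -> R) (d : R) (i : nat) : continuous h ->
  measurable_fun [set: borelT T] (fun x => (d * i%:R < h x)%R%:R%:E : \bar R).
Proof.
move=> ch; rewrite (_ : (fun x => _) = EFin \o \1_[set x | d * i%:R < h x]).
  apply/measurable_EFinP; apply: measurable_indic.
  by apply: sub_sigma_algebra; exact: open_superlevel.
by apply/funext => x /=; rewrite indicE mem_setE.
Qed.

Lemma measurable_layer_sum (h : T -> R) (d : R) (m : nat) : continuous h ->
  measurable_fun [set: borelT T]
    (fun x => (\sum_(i < m) (d * i%:R < h x)%R%:R)%:E : \bar R).
Proof.
move=> ch; under eq_fun do rewrite -sumEFin.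
by apply: emeasurable_sum => i; exact: measurable_layer.
Qed.

Lemma integral_layer_sum (Q : probability (borelT T) R) (h : T -> R) (d : R)
    (m : nat) : continuous h -> 0 <= d ->
  (\int[Q]_x (d * \sum_(i < m) (d * i%:R < h x)%R%:R)%:E =
   d%:E * \sum_(i < m) Q [set x | d * i%:R < h x]%R)%E.
Proof.
move=> ch d0; under eq_integral do rewrite EFinM.
rewrite ge0_integralZl_EFin//.
- congr (_ * _)%E; under eq_integral do rewrite -sumEFin.
  rewrite ge0_integral_sum//; last by move=> i; exact: measurable_layer.
  apply: eq_bigr => i _; rewrite -[in RHS](setIT [set x | _]) -integral_indic//.
    by apply: eq_integral => x _; rewrite indicE mem_setE.
  by apply: sub_sigma_algebra; exact: open_superlevel.
- by move=> x _; rewrite lee_fin sumr_ge0.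
- exact: measurable_layer_sum.
Qed.

End layers.

(** * Weak convergence from lower bounds on open sets *)

Section weak_convergence.
Context {R : realType} {T : ptopologicalType}.
Variables (P : nat -> probability (borelT T) R) (nu : probability (borelT T) R).
Hypothesis open_liminf : forall O : set T, open O -> forall e : R, 0 < e ->
  \forall n \near \oo, (nu O <= P n O + e%:E)%E.

Lemma liminf_integral_nneg (h : T -> R) (C : R) : continuous h ->
  (forall x, 0 <= h x <= C) -> forall e : R, 0 < e ->
  \forall n \near \oo, (\int[nu]_x (h x)%:E <= \int[P n]_x (h x)%:E + e%:E)%E.
Proof.
move=> ch hC e e0.
(* The rounding error of the layer sum is [d = e / 2]; [m] levels reach the bound [C]; and [e'] is
   chosen so that the [m] measure errors, weighted by [d], total [e / 2]. *)
pose d := e / 2; have d0 : 0 < d by rewrite divr_gt0.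
pose m := (Num.truncn (C / d)).+1.
have Cm : C <= d * m%:R.
  by rewrite -ler_pdivrMl// mulrC ltW// truncnS_gt.
pose e' := e / 2 / (d * m%:R); have e'0 : 0 < e' by rewrite !divr_gt0// mulr_gt0.
have hb x : 0 <= h x <= d * m%:R.
  by have /andP[-> /le_trans ->] := hC x.
have bnd x := layer_sum_bounds (ltW d0) (hb x).
have oO i : open [set x | d * i%:R < h x].
  exact: open_superlevel.
have hCabs x : `|h x| <= C by have /andP[h0 hle] := hC x; rewrite ger0_norm.
have ih Q := bounded_continuous_integrable Q ch hCabs.
have mS : measurable_fun [set: borelT T] (fun x =>
   (d * \sum_(i < m) (d * i%:R < h x)%R%:R)%:E : \bar R).
  under eq_fun do rewrite EFinM.
  by apply: measurable_funeM; exact: measurable_layer_sum.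
have mh := measurable_int _ (ih nu).
have : \forall n \near \oo, forall i : 'I_m,
    (nu [set x | d * i%:R < h x]%R <= P n [set x | d * i%:R < h x]%R + e'%:E)%E.
  by apply: filter_forall => i; exact: (open_liminf (oO i) e'0).
apply: filterS => n nuP.
apply: (@le_trans _ _ (\int[nu]_x (d * \sum_(i < m) (d * i%:R < h x)%R%:R)%:E)%E).
  apply: ge0_le_integral => //.
  - by move=> x _; rewrite lee_fin; have /andP[] := hC x.
  - by move=> x _; rewrite lee_fin; have /andP[] := bnd x.
rewrite integral_layer_sum ?(ltW d0)//.
apply: (@le_trans _ _ (d%:E * \sum_(i < m) P n [set x | d * i%:R < h x]%R +
    (e / 2)%:E)%E).
  apply: (@le_trans _ _ (d%:E * \sum_(i < m)
      (P n [set x | d * i%:R < h x]%R + e'%:E))%E).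
    by apply: lee_wpmul2l; [rewrite lee_fin ltW|apply: lee_sum => i _; exact: nuP].
  rewrite big_split/= ge0_muleDr; [|exact: sume_ge0|].
  - rewrite leeD2l// sumEFin -EFinM lee_fin sumr_const card_ord.
    rewrite -[e' *+ m]mulr_natr mulrCA /e' divfK// gt_eqF// mulr_gt0//.
  - by apply: sume_ge0 => i _; rewrite lee_fin ltW.
rewrite -integral_layer_sum ?(ltW d0)//.
have -> : e%:E = (d%:E + (e / 2)%:E)%E by rewrite -EFinD -splitr.
rewrite addeA leeD2r//.
have <- : (\int[P n]_x ((h x)%:E + d%:E) = \int[P n]_x (h x)%:E + d%:E)%E.
  rewrite ge0_integralD//=.
  - by rewrite integral_cst_probability.
  - by move=> x _; rewrite lee_fin; have /andP[] := hC x.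
  - by move=> x _; rewrite lee_fin ltW.
apply: ge0_le_integral => //.
- move=> x _; rewrite lee_fin; have /andP[h0 _] := hb x.
  by apply: le_trans h0 _; have /andP[] := bnd x.
- by apply: emeasurable_funD.
- by move=> x _; rewrite -EFinD lee_fin; have /andP[] := bnd x.
Qed.

(** The one-sided estimate for the nonnegative functions [h + C] and [C - h] bounds the integrals of
    [h] from both sides, since the constants integrate to themselves under every probability. *)
Lemma weak_cvg_of_open_liminf (h : T -> R) (C : R) : continuous h ->
  (forall x, `|h x| <= C) ->
  (fun n => \int[P n]_x (h x)%:E)%E @ \oo --> (\int[nu]_x (h x)%:E)%E.
Proof.
move=> ch hC.
have ih Q := bounded_continuous_integrable Q ch hC.
have fin (Q : probability (borelT T) R) :
    (\int[Q]_x (h x)%:E)%E \is a fin_num := integrable_fin_num measurableT (ih Q).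
have hN x : - C <= h x <= C by rewrite -ler_norml.
have intD (Q : probability (borelT T) R) (c : R) :
    (\int[Q]_x (h x + c)%:E = \int[Q]_x (h x)%:E + c%:E)%E.
  under eq_integral do rewrite EFinD.
  rewrite integralD//=; last exact: finite_measure_integrable_cst.
  by rewrite integral_cst_probability.
have intB (Q : probability (borelT T) R) (c : R) :
    (\int[Q]_x (c - h x)%:E = c%:E - \int[Q]_x (h x)%:E)%E.
  under eq_integral do rewrite EFinB.
  rewrite integralB//=; last exact: finite_measure_integrable_cst.
  by rewrite integral_cst_probability.
rewrite -(fineK (fin nu)); apply: cvg_EFin; first exact: nearW.
apply/cvgrPdist_le => e e0.
have cD : continuous (fun x => h x + C).
  by move=> x; apply: cvgD; [exact: ch|exact: cvg_cst].
have cB : continuous (fun x => C - h x).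
  by move=> x; apply: cvgB; [exact: cvg_cst|exact: ch].
have D1 := @liminf_integral_nneg _ (C + C) cD _ _ e0.
have D2 := @liminf_integral_nneg _ (C + C) cB _ _ e0.
near=> n.
have : (\int[nu]_x (h x + C)%:E <= \int[P n]_x (h x + C)%:E + e%:E)%E.
  by near: n; apply: D1 => x; have /andP[h1 h2] := hN x; apply/andP; split; lra.
have : (\int[nu]_x (C - h x)%:E <= \int[P n]_x (C - h x)%:E + e%:E)%E.
  by near: n; apply: D2 => x; have /andP[h1 h2] := hN x; apply/andP; split; lra.
rewrite !intD !intB /= -(fineK (fin nu)) -(fineK (fin (P n))).
rewrite -!EFinN -!EFinD !lee_fin => h1 h2.
by rewrite ler_norml; apply/andP; split; lra.
Unshelve. all: by end_near. Qed.

End weak_convergence.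

(** * Measures with a density *)

(** The integration formula comes from the Radon-Nikodym change of variables: [f] agrees almost
    everywhere with the derivative, both having the same integral over every measurable set. *)
Lemma density_probability d (T : measurableType d) (R : realType)
    (mu : probability T R) (f : T -> R) :
  measurable_fun setT f -> (forall x, 0 <= f x) ->
  (\int[mu]_x (f x)%:E = 1)%E ->
  exists2 P : probability T R,
    (forall A, measurable A -> P A = \int[mu]_(x in A) (f x)%:E)%E &
    (forall h : T -> R, P.-integrable setT (EFin \o h) ->
      \int[P]_x (h x)%:E = \int[mu]_x (h x * f x)%:E)%E.
Proof.
move=> mf f0 intf.
have mfE : measurable_fun setT (EFin \o f) by exact/measurable_EFinP.
pose nuf A := (\int[mu]_(x in A) (f x)%:E)%E.
have nuf0 : nuf set0 = 0%E by exact: integral_set0.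
have nuf_ge0 A : (0 <= nuf A)%E.
  by apply: integral_ge0 => x _; rewrite lee_fin.
have nuf_sadd : semi_sigma_additive nuf.
  by apply: semi_sigma_additive_nng_induced => // x; rewrite lee_fin.
pose nu : {measure set T -> \bar R} :=
  HB.pack nuf (isMeasure.Build _ T R nuf nuf0 nuf_ge0 nuf_sadd).
have [P PE] := measure_probability (intf : nu setT = 1%E).
exists P => [A mA|h ih]; first exact: PE.
have Pmu : P `<< mu.
  apply/null_content_dominatesP => A mA muA0; rewrite PE.
  by apply: null_set_integral => //; exact: measurable_funTS.
have if_ : mu.-integrable setT (EFin \o f).
  apply/integrableP; split => //; under eq_integral do rewrite /= ger0_norm//.
  by rewrite intf ltry.
rewrite -(Radon_Nikodym_change_of_variables Pmu)//.
have fd : ae_eq mu setT (EFin \o f)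
    (Radon_Nikodym (charge_of_finite_measure P) mu).
  apply: integral_ae_eq => // A _ mA.
  by rewrite -Radon_Nikodym_integral//= -PE.
have mh := measurable_int _ ih.
apply: ae_eq_integral => //.
- by apply: emeasurable_funM.
- under eq_fun do rewrite EFinM.
  by apply: emeasurable_funM.
by apply: filterS fd => x /(_ Logic.I) fdx _; rewrite -fdx EFinM.
Qed.

(** * Energy estimates *)

(* [ln 0 = 0] in the library, so the case split of [xlogx] is redundant. *)
Lemma xlogxE (R : realType) (x : R) : xlogx x = x * ln x.
Proof. by rewrite /xlogx; case: eqP => // ->; rewrite mul0r. Qed.

(** For [x > 0], the inequality [ln (1 + t) <= t] at [t = 1 / x - 1] gives [x * ln x >= x - 1]. *)
Lemma xlogx_geN1 (R : realType) (x : R) : 0 <= x -> -1 <= xlogx x.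
Proof.
rewrite le_eqVlt xlogxE => /orP[/eqP <-|x0].
  by rewrite mul0r lerN10.
have := @le_ln1Dx _ (x^-1 - 1); rewrite ltrBrDl subrr invr_gt0 => /(_ x0).
rewrite addrC subrK lnV// -(ler_pM2l x0) mulrN mulrBr mulr1 mulfV ?gt_eqF//.
by lra.
Qed.

(** * Lipschitz functions and balls in a metric space *)

Lemma lipschitz_continuous (R : realType) (M : pointedMetricType R) (L : R)
    (f : M -> R) : 0 < L -> (forall p q, `|f p - f q| <= L * mdist p q) ->
  continuous f.
Proof.
move=> L0 flip p; apply/cvgrPdist_le => e e0; apply/nbhs_ballP.
exists (e / L); first by rewrite /= divr_gt0.
move=> q; rewrite ballEmdist/= => pq; apply: le_trans (flip _ _) _.
by rewrite mulrC -ler_pdivlMr// ltW.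
Qed.

Lemma mdist_lipschitz (R : realType) (M : pointedMetricType R) (x p q : M) :
  `|mdist x p - mdist x q| <= mdist p q.
Proof.
have h1 := metric_triangle x p q; have h2 := metric_triangle x q p.
by rewrite ler_norml (metric_sym q p) in h2 *; apply/andP; split; lra.
Qed.

Lemma mdist_continuous (R : realType) (M : pointedMetricType R) (x : M) :
  continuous (mdist x : M -> R).
Proof.
apply: (@lipschitz_continuous _ _ 1) => // p q.
by rewrite mul1r mdist_lipschitz.
Qed.

Lemma open_mball (R : realType) (M : pointedMetricType R) (x : M) (e : R) :
  open [set y | mdist x y < e].
Proof.
have oe : open [set y : R | y < e] by exact: open_lt.
by have /continuousP/(_ _ oe) := @mdist_continuous _ _ x.
Qed.

Lemma compact_mdist_bounded (R : realType) (M : pointedMetricType R) :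
  compact [set: M] -> exists D : R, forall x y : M, mdist x y <= D.
Proof.
move=> cM; pose x0 : M := point.
have : compact (mdist x0 @` [set: M] : set R).
  apply: continuous_compact => //; apply: continuous_subspaceT.
  exact: mdist_continuous.
move=> /compact_bounded[D [_ /(_ (D + 1))]]; rewrite ltrDl ltr01 => /(_ isT) Db.
have b x : mdist x0 x <= D + 1.
  by apply: le_trans (ler_norm _) _; apply: Db; exists x.
exists (D + 1 + (D + 1)) => x y; apply: le_trans (metric_triangle x x0 y) _.
by rewrite lerD// metric_sym.
Qed.

(** * Balls of positive measure, and integrability from a lower bound *)

Lemma measure_bigsetU_null d (T : measurableType d) (R : realType)
    (mu : {measure set T -> \bar R}) (I : Type) (s : seq I) (F : I -> set T) :
  (forall i, measurable (F i)) -> (forall i, mu (F i) = 0%E) ->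
  mu (\big[setU/set0]_(i <- s) F i) = 0%E.
Proof.
move=> mF F0; elim: s => [|i s IH]; first by rewrite big_nil measure0.
apply/eqP; rewrite eq_le measure_ge0 andbT big_cons.
apply: le_trans (measureU2 mu _ _) _ => //.
  by apply: bigsetU_measurable => j _.
by rewrite [X in (X + _)%E]F0 [X in (_ + X)%E]IH adde0.
Qed.

(** Otherwise compactness would cover the space by finitely many null balls. *)
Lemma exists_mball_gt0 (R : realType) (M : pointedMetricType R)
    (mu : probability (borelT M) R) (e : R) : compact [set: M] -> 0 < e ->
  exists x : M, (0 < mu [set y | mdist x y < e]%R)%E.
Proof.
move=> cM e0; apply: contrapT => /forallNP nx.
pose B (x : M) : set (borelT M) := [set y | mdist x y < e].
have mB x : measurable (B x) by apply: sub_sigma_algebra; exact: open_mball.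
have B0 x : mu (B x) = 0%E.
  by apply/eqP; rewrite eq_le measure_ge0 andbT leNgt; apply/negP; exact: nx.
move: cM; rewrite compact_cover => /(_ _ setT B)[].
- by move=> x _; exact: open_mball.
- by move=> x _; exists x => //=; rewrite /B/= mdistxx.
move=> s _ cs.
have : mu (\big[setU/set0]_(x <- finmap.enum_fset s) B x) = 0%E.
  exact: measure_bigsetU_null.
rewrite (_ : \big[setU/set0]_(x <- _) _ = setT).
  by rewrite probability_setT => /eqP; rewrite onee_eq0.
apply/seteqP; split => // x _; have [y ys Bx] := cs x Logic.I.
by rewrite -bigcup_seq; exists y.
Qed.

(** The negative part is at most [c], hence has finite integral, and then the upper bound on the
    integral controls the positive part. Energy densities satisfy this with [c = 1]. *)
Lemma integrable_of_bounded_below d (T : measurableType d) (R : realType)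
    (mu : probability T R) (F : T -> \bar R) (c : R) :
  measurable_fun setT F -> 0 <= c -> (forall x, (- c)%:E <= F x)%E ->
  (\int[mu]_x F x < +oo)%E -> mu.-integrable setT F.
Proof.
move=> mF c0 Fge iF.
have mFp : measurable_fun setT F^\+%E by exact: measurable_funepos.
have mFn : measurable_fun setT F^\-%E by exact: measurable_funeneg.
have iFn : (\int[mu]_x F^\- x < +oo)%E.
  apply: (@le_lt_trans _ _ (\int[mu]_x c%:E)%E).
    apply: ge0_le_integral => //.
    move=> x _; rewrite funenegE ge_max lee_fin c0 andbT.
    by rewrite leeNl -EFinN.
  by rewrite integral_cst_probability ltry.
have iFp : (\int[mu]_x F^\+ x < +oo)%E.
  move: iF; rewrite integralE lteBlDr ?ge0_fin_numE ?integral_ge0//.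
  by rewrite addye// gt_eqF// (lt_le_trans _ (integral_ge0 _ _)) ?ltNyr.
apply/integrableP; split => //.
under eq_integral do rewrite -[(`|F _|)%E]/((abse \o F) _) fune_abse.
by rewrite ge0_integralD//= lte_add_pinfty.
Qed.

(** * Upper and lower bounds for the energy of admissible densities *)

Section energy_bounds.
Context {R : realType} {M : pointedMetricType R}.
Variables (mu : probability (borelT M) R) (k : M -> M -> R) (L : R).
Hypothesis Mcompact : compact [set: M].
Hypothesis k_ge0 : forall p q, 0 <= k p q.
Hypothesis k_sym : forall p q, k p q = k q p.
Hypothesis k_diag : forall p, k p p = 0.
Hypothesis L_gt0 : 0 < L.
Hypothesis k_lip : forall p q s, `|k p s - k q s| <= L * mdist p q.

Lemma kernel_le_mdist p q : k p q <= L * mdist p q.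
Proof. by have := k_lip p q q; rewrite k_diag subr0 ger0_norm. Qed.

Lemma measurable_kernel p : measurable_fun [set: borelT M] (k p).
Proof.
apply: continuous_borel_measurable; apply: (lipschitz_continuous L_gt0) => q s.
by rewrite !(k_sym p).
Qed.

Section admissible_density.
Variable f : M -> R.
Hypothesis f_adm : admissible mu f.

Let mf : measurable_fun [set: borelT M] f. Proof. by case: f_adm. Qed.
Let f0 x : 0 <= f x. Proof. by case: f_adm. Qed.
Let intf : (\int[mu]_x (f x)%:E = 1)%E. Proof. by case: f_adm. Qed.

Lemma Upot_ge0 p : (0 <= Upot mu k f p)%E.
Proof. by apply: integral_ge0 => q _; rewrite lee_fin mulr_ge0. Qed.

Lemma measurable_kernelM p :
  measurable_fun [set: borelT M] (fun q => (k p q * f q)%:E).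
Proof.
apply/measurable_EFinP; apply: measurable_funM => //; exact: measurable_kernel.
Qed.

Lemma Upot_fin_num p : Upot mu k f p \is a fin_num.
Proof.
rewrite ge0_fin_numE ?Upot_ge0//.
have [D Db] := compact_mdist_bounded Mcompact.
have D0 : 0 <= L * D by rewrite mulr_ge0 ?(ltW L_gt0)// (le_trans _ (Db p p))// mdist_ge0.
apply: (@le_lt_trans _ _ (\int[mu]_q ((L * D)%:E * (f q)%:E))%E).
  apply: ge0_le_integral => //.
  - by move=> q _; rewrite lee_fin mulr_ge0.
  - exact: measurable_kernelM.
  - by apply: measurable_funeM; exact/measurable_EFinP.
  - move=> q _; rewrite -EFinM lee_fin ler_wpM2r//.
    by rewrite (le_trans (kernel_le_mdist p q))// ler_wpM2l// ltW.
rewrite ge0_integralZl_EFin//; last 2 first.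
- by move=> q _; rewrite lee_fin.
- exact/measurable_EFinP.
by rewrite intf mule1 ltry.
Qed.

(** The Lipschitz bound of the kernel is integrated against [f], which has mass one. Together with
    finiteness this makes the potential continuous, hence measurable. *)
Lemma Upot_le p q : (Upot mu k f p <= Upot mu k f q + (L * mdist p q)%:E)%E.
Proof.
have d0 : 0 <= L * mdist p q by rewrite mulr_ge0 ?(ltW L_gt0)// mdist_ge0.
have mfE : measurable_fun [set: borelT M] (EFin \o f) by exact/measurable_EFinP.
have <- : (\int[mu]_s ((k q s * f s)%:E + (L * mdist p q)%:E * (f s)%:E) =
    Upot mu k f q + (L * mdist p q)%:E)%E.
  rewrite ge0_integralD//=.
  - rewrite ge0_integralZl_EFin//; last by move=> s _; rewrite lee_fin.
    by rewrite intf mule1.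
  - by move=> s _; rewrite lee_fin mulr_ge0.
  - exact: measurable_kernelM.
  - by move=> s _; rewrite -EFinM lee_fin mulr_ge0.
  - by apply: measurable_funeM.
apply: ge0_le_integral => //.
- by move=> s _; rewrite lee_fin mulr_ge0.
- exact: measurable_kernelM.
- by apply: emeasurable_funD; [exact: measurable_kernelM|exact: measurable_funeM].
- move=> s _; rewrite -EFinM -EFinD lee_fin -mulrDl ler_wpM2r//.
  by rewrite -lerBlDl; apply: le_trans (ler_norm _) (k_lip _ _ _).
Qed.

Lemma measurable_Upot : measurable_fun [set: borelT M] (Upot mu k f).
Proof.
have -> : Upot mu k f = EFin \o (fine \o Upot mu k f).
  by apply/funext => p; rewrite /= fineK// Upot_fin_num.
apply/measurable_EFinP; apply: continuous_borel_measurable.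
apply: (lipschitz_continuous L_gt0) => p q /=.
have := Upot_le p q; have := Upot_le q p; rewrite (metric_sym q p).
rewrite -(fineK (Upot_fin_num p)) -(fineK (Upot_fin_num q)) -!EFinD !lee_fin /=.
by move=> h1 h2; rewrite ler_norml; apply/andP; split; lra.
Qed.

Lemma measurable_energy_density b : measurable_fun [set: borelT M]
  (fun p => (xlogx (f p))%:E + (b / 2 * f p)%:E * Upot mu k f p)%E.
Proof.
apply: emeasurable_funD.
  apply/measurable_EFinP; rewrite (_ : (fun p => _) = f \* (@ln R \o f)).
    by apply: measurable_funM => //; exact: measurableT_comp.
  by apply/funext => p; rewrite xlogxE.
apply: emeasurable_funM; last exact: measurable_Upot.
by apply/measurable_EFinP; exact: measurable_funM.
Qed.

Lemma energy_density_integrable b : 0 < b -> (Eb mu k b f < +oo)%E ->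
  mu.-integrable [set: borelT M]
    (fun p => (xlogx (f p))%:E + (b / 2 * f p)%:E * Upot mu k f p)%E.
Proof.
move=> b0; apply: (@integrable_of_bounded_below _ _ _ _ _ 1) => //.
  exact: measurable_energy_density.
move=> x; rewrite -[leLHS]adde0 leeD ?lee_fin ?xlogx_geN1//.
by rewrite mule_ge0 ?Upot_ge0// lee_fin mulr_ge0// divr_ge0// ltW.
Qed.

(** Pointwise, the entropy term is at least [-1], and on [A] the potential is at least [c] times the
    mass of [B]. Finite energy makes the density integrable, so that these signed functions can be
    compared under the integral. *)
Lemma Eb_ge b (A B : set (borelT M)) (c : R) : 0 < b -> 0 <= c ->
  measurable A -> measurable B -> (forall p q, A p -> B q -> c <= k p q) ->
  (Eb mu k b f < +oo)%E ->
  ((-1)%:E + (b / 2 * c)%:E *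
    (\int[mu]_(x in A) (f x)%:E * \int[mu]_(x in B) (f x)%:E) <= Eb mu k b f)%E.
Proof.
move=> b0 c0 mA mB kc Efin.
have mfE : measurable_fun [set: borelT M] (EFin \o f) by exact/measurable_EFinP.
have if_ : mu.-integrable [set: borelT M] (EFin \o f).
  apply/integrableP; split => //; under eq_integral do rewrite /= ger0_norm//.
  by rewrite intf ltry.
have ifS C : measurable C -> mu.-integrable C (EFin \o f).
  by move=> mC; exact: integrableS if_.
have fin C : measurable C -> (\int[mu]_(x in C) (f x)%:E)%E \is a fin_num.
  by move=> mC; exact: integrable_fin_num (ifS C mC).
set beta := (\int[mu]_(x in B) (f x)%:E)%E.
have beta0 : (0 <= beta)%E by apply: integral_ge0 => x _; rewrite lee_fin.
have Ube x : A x -> (c%:E * beta <= Upot mu k f x)%E.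
  move=> Ax; rewrite /beta -ge0_integralZl_EFin//; last 2 first.
  - by move=> q _; rewrite lee_fin.
  - exact: measurable_funTS.
  apply: (@le_trans _ _ (\int[mu]_(q in B) (k x q * f q)%:E)%E).
    apply: ge0_le_integral => //.
    - by move=> q _; rewrite -EFinM lee_fin mulr_ge0.
    - by apply: measurable_funeM; exact: measurable_funTS.
    - by apply: measurable_funTS; exact: measurable_kernelM.
    - by move=> q Bq; rewrite -EFinM lee_fin ler_wpM2r// kc.
  apply: ge0_subset_integral => //; first exact: measurable_kernelM.
  by move=> q _; rewrite lee_fin mulr_ge0.
have iA : mu.-integrable [set: borelT M] ((EFin \o f) \_ A).
  by rewrite -integrable_mkcond//; exact: ifS.
have bE : (fine beta)%:E = beta by rewrite fineK// fin.
(* The lower bound for the integrand is [-1 + r * f] on [A] and [-1] elsewhere. *)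
pose r := b / 2 * c * fine beta.
have -> : ((-1)%:E + (b / 2 * c)%:E * (\int[mu]_(x in A) (f x)%:E * beta) =
    \int[mu]_x ((-1)%:E + r%:E * ((EFin \o f) \_ A) x))%E.
  rewrite integralD//=; last 2 first.
  - exact: finite_measure_integrable_cst.
  - exact: integrableZl.
  rewrite integral_cst_probability integralZl// -integral_mkcond.
  by rewrite (muleC _ beta) -bE muleA -EFinM.
apply: le_integral => //.
- apply: integrableD => //; first exact: finite_measure_integrable_cst.
  exact: integrableZl.
- exact: energy_density_integrable.
move=> x _; apply: leeD; first by rewrite lee_fin xlogx_geN1.
have bf : 0 <= b / 2 * f x by rewrite mulr_ge0// divr_ge0// ltW.
rewrite patchE; case: ifPn => [|_]; last by rewrite mule0 mule_ge0// Upot_ge0.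
rewrite inE => Ax; rewrite (_ : r%:E * _ = (b / 2 * f x)%:E * (c%:E * beta))%E.
  by rewrite lee_wpmul2l// ?lee_fin// Ube.
by rewrite -bE -!EFinM; congr (_%:E); rewrite /r /=; ring.
Qed.

End admissible_density.

(** Taken on a small ball, this uniform density is the competitor for the minimisers. *)
Lemma normalized_indic_admissible (B : set (borelT M)) : measurable B ->
  (0 < mu B)%E -> admissible mu (fun x => \1_B x / fine (mu B)).
Proof.
move=> mB B0; split.
- by apply: measurable_funM => //; exact: measurable_indic.
- by move=> x; rewrite divr_ge0// fine_ge0.
- under eq_integral do rewrite mulrC EFinM.
  rewrite ge0_integralZl_EFin//; last 2 first.
  + by apply/measurable_EFinP; exact: measurable_indic.
  + by rewrite invr_ge0 fine_ge0.
  rewrite integral_indic// setIT -[X in (_ * X)%E]fineK ?fin_num_measure//.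
  by rewrite -EFinM mulVf// fine_eq0 ?fin_num_measure// gt_eqF.
Qed.

(** On [B] the density is [1 / m] with [m] the mass of [B], its logarithm is [- ln m] and the
    potential is at most [c]. So the integrand is at most a constant times the density, whose
    integral is one. *)
Lemma Eb_normalized_indic_le (B : set (borelT M)) b (c : R) : measurable B ->
  (0 < mu B)%E -> 0 < b -> 0 <= c -> (forall p q, B p -> B q -> k p q <= c) ->
  (Eb mu k b (fun x => \1_B x / fine (mu B))%R <= (- ln (fine (mu B)) + b / 2 * c)%:E)%E.
Proof.
move=> mB B0 b0 c0 kc.
have adm := normalized_indic_admissible mB B0.
have muBE : mu B = (fine (mu B))%:E by rewrite fineK// fin_num_measure.
set m := fine (mu B) in adm muBE *; set f := (fun x => _) in adm *.
have m0 : 0 < m by rewrite -lte_fin -muBE.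
(* This makes [- ln m] nonnegative, so both integrands are nonnegative and can be compared
   directly. *)
have m1 : m <= 1 by rewrite -lee_fin -muBE probability_le1.
have lnm : 0 <= - ln m by rewrite oppr_ge0 ln_le0.
have [mf f0 intf] := adm.
have fB x : B x -> f x = m^-1 by move=> Bx; rewrite /f indicE mem_set// div1r.
have fnB x : ~ B x -> f x = 0 by move=> Bx; rewrite /f indicE memNset// mul0r.
have mfE : measurable_fun [set: borelT M] (EFin \o f) by exact/measurable_EFinP.
have bc0 : 0 <= - ln m + b / 2 * c by rewrite addr_ge0// mulr_ge0// divr_ge0// ltW.
have UB x : B x -> (Upot mu k f x <= c%:E)%E.
  move=> Bx; rewrite -[leRHS]mule1 -intf -ge0_integralZl_EFin//; last first.
    by move=> q _; rewrite lee_fin.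
  apply: ge0_le_integral => //.
  - by move=> q _; rewrite lee_fin mulr_ge0.
  - exact: measurable_kernelM.
  - exact: measurable_funeM.
  - move=> q _; rewrite -EFinM lee_fin; have [Bq|nBq] := pselect (B q).
      by rewrite ler_wpM2r// kc.
    by rewrite fnB// !mulr0.
rewrite -[leRHS]mule1 -intf -ge0_integralZl_EFin//; last first.
  by move=> q _; rewrite lee_fin.
apply: ge0_le_integral => //.
- move=> x _; rewrite adde_ge0//; last first.
    by rewrite mule_ge0 ?Upot_ge0// lee_fin mulr_ge0// divr_ge0// ltW.
  rewrite lee_fin xlogxE; have [Bx|nBx] := pselect (B x).
    by rewrite fB// lnV// mulr_ge0// invr_ge0 ltW.
  by rewrite fnB// mul0r.
- exact: measurable_energy_density.
- exact: measurable_funeM.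
- move=> x _; have [Bx|nBx] := pselect (B x); last first.
    by rewrite fnB// xlogxE !mulr0 mul0r mul0e adde0 mule0.
  rewrite fB// xlogxE lnV// mulrC -EFinM mulrDl EFinD leeD2l//.
  rewrite [in leRHS]mulrAC [leRHS]EFinM lee_wpmul2l ?UB// lee_fin mulr_ge0//.
    by rewrite divr_ge0// ltW.
  by rewrite invr_ge0 ltW.
Qed.

End energy_bounds.

(** * Weak convergence of the minimisers and the support of the limit *)

Theorem theorem2 (R : realType) (M : pointedMetricType R)
  (mu : probability (borelT M) R) (k : M -> M -> R) (L : R)
  (Mcompact : compact [set: M])
  (k_ge0 : forall p q, 0 <= k p q)
  (k_sym : forall p q, k p q = k q p)
  (k_diag : forall p, k p p = 0)
  (L_gt0 : 0 < L)
  (k_lip : forall p q s, `|k p s - k q s| <= L * mdist p q)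
  (b : nat -> R) (b_gt0 : forall n, 0 < b n) (b_oo : b @ \oo --> +oo)
  (g : nat -> M -> R)
  (g_adm : forall n, admissible mu (g n))
  (g_min : forall n f, admissible mu f -> (Eb mu k (b n) (g n) <= Eb mu k (b n) f)%E) :
  exists (phi : nat -> nat) (nu : probability (borelT M) R),
    {homo phi : m n / (m < n)%N >-> (m < n)%N} /\
    (forall h : M -> R, continuous h -> (exists C, forall x, `|h x| <= C) ->
       (fun n => (\int[mu]_x (h x * g (phi n) x)%:E)%E) @ \oo
         --> (\int[nu]_x (h x)%:E)%E) /\
    exists A : set (borelT M),
      [/\ measurable A, nu A = 1%E & forall p q, A p -> A q -> k p q = 0].
Proof.
have hM : hausdorff_space M by exact: metric_hausdorff.
have scM : @second_countable M by exact: (compact_second_countable Mcompact).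
have /choice[P PP] n : exists P : probability (borelT M) R,
    (forall A, measurable A -> P A = \int[mu]_(x in A) (g n x)%:E)%E /\
    (forall h : M -> R, P.-integrable [set: borelT M] (EFin \o h) ->
      \int[P]_x (h x)%:E = \int[mu]_x (h x * g n x)%:E)%E.
  by have [mg g0 intg] := g_adm n; have [P] := density_probability mg g0 intg; exists P.
have [phi [nu [phi_mono nuP]]] := open_liminf_subsequence P hM Mcompact scM.
exists phi, nu; split=> //; split.
  move=> h ch [C hC].
  rewrite (_ : (fun n => _) = (fun n => (\int[P (phi n)]_x (h x)%:E)%E)).
    exact: (@weak_cvg_of_open_liminf _ _ (P \o phi) nu nuP h C ch hC).
  apply/funext => n; rewrite (PP _).2//.
  exact: bounded_continuous_integrable ch hC.
have [W oW WE] := second_countable_open_cover scM.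
(* The largest open [nu]-null set; its complement, the support of [nu], serves as [A]. *)
pose N : set (borelT M) := \bigcup_(i in [set i | nu (W i) = 0%E]) W i.
have mW i : measurable (W i : set (borelT M)) by exact: sub_sigma_algebra.
have mN : measurable N by apply: bigcup_measurable => i _; exact: mW.
have nuN : nu N = 0%E.
  apply: measure_negligible => //; rewrite /N bigcup_mkcond.
  apply: negligible_bigcup => i; case: ifPn => [|_]; last exact: negligible_set0.
  by rewrite inE => nuW0; exists (W i); split.
have nu_mball p r : ~ N p -> 0 < r -> (0 < nu [set y | mdist p y < r]%R)%E.
  move=> nNp r0; rewrite lt_neqAle measure_ge0 andbT; apply/negP => /eqP nu0.
  have : [set y | mdist p y < r] p by rewrite /= mdistxx.
  rewrite {1}(WE _ (@open_mball _ _ p r)) => -[i /= iB Wip]; apply: nNp.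
  exists i => //=; apply/eqP; rewrite eq_le measure_ge0 andbT nu0.
  apply: le_measure; rewrite ?inE//.
  by apply: sub_sigma_algebra; exact: open_mball.
exists (~` N); split; first exact: measurableC.
  by rewrite probability_setC// nuN sube0.
move=> p q nNp nNq; apply/eqP; rewrite eq_le k_ge0 andbT leNgt; apply/negP => k0.
have mB (x : M) (r : R) : measurable ([set y | mdist x y < r] : set (borelT M)).
  by apply: sub_sigma_algebra; exact: open_mball.
(* Moving each argument by less than [r] changes [k] by at most a quarter of [k p q], so at least
   half of it remains on [Bp] times [Bq]. *)
pose r := k p q / (4 * L).
have r0 : 0 < r by rewrite divr_gt0// mulr_gt0.
pose Bp : set (borelT M) := [set y | mdist p y < r].
pose Bq : set (borelT M) := [set y | mdist q y < r].
have kBpq x y : Bp x -> Bq y -> k p q / 2 <= k x y.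
  move=> /= px qy.
  have h1 := le_trans (ler_norm _) (k_lip p x q).
  have h2 := le_trans (ler_norm _) (k_lip q y x).
  rewrite !(k_sym _ x) in h2.
  have Lr : L * r = k p q / 4 by rewrite /r; field; rewrite gt_eqF.
  have h3 : L * mdist p x <= k p q / 4 by rewrite -Lr ler_wpM2l// ltW.
  have h4 : L * mdist q y <= k p q / 4 by rewrite -Lr ler_wpM2l// ltW.
  by lra.
have nuBp := nu_mball p r nNp r0; have nuBq := nu_mball q r nNq r0.
have fE (Q : probability (borelT M) R) A : measurable A -> (fine (Q A))%:E = Q A.
  by move=> mA; rewrite fineK// fin_num_measure.
have mBp : measurable Bp by exact: mB.
have mBq : measurable Bq by exact: mB.
pose al := fine (nu Bp); pose be := fine (nu Bq).
have al0 : 0 < al by rewrite -lte_fin fE.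
have be0 : 0 < be by rewrite -lte_fin fE.
(* With this [c], the lower energy bound beats the upper one by [b_n / 2 * c]. *)
pose c := k p q * (al * be) / 16.
have c0 : 0 < c by rewrite divr_gt0// !mulr_gt0.
(* Two points of a ball of this radius are less than [c / L] apart, which keeps [k] below [c]
   there. *)
have rho0 : 0 < c / (2 * L) by rewrite divr_gt0// mulr_gt0.
have [z muz] := exists_mball_gt0 mu Mcompact rho0.
pose Bz : set (borelT M) := [set y | mdist z y < c / (2 * L)].
have kBz x y : Bz x -> Bz y -> k x y <= c.
  move=> /= zx zy; apply: le_trans (kernel_le_mdist k_ge0 k_diag k_lip x y) _.
  have := metric_triangle x z y; rewrite (metric_sym x z) => xy.
  have Lr : L * (c / (2 * L)) = c / 2 by field; rewrite gt_eqF.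
  have h1 : L * mdist z x <= c / 2 by rewrite -Lr ler_wpM2l// ltW.
  have h2 : L * mdist z y <= c / 2 by rewrite -Lr ler_wpM2l// ltW.
  have := ler_wpM2l (ltW L_gt0) xy; rewrite mulrDr; lra.
pose m := fine (mu Bz).
have phi_ge n : (n <= phi n)%N.
  by elim: n => // n IH; exact: leq_ltn_trans IH (phi_mono _ _ (ltnSn n)).
(* One index at which both balls keep half of their limit mass and [1 - ln m < b (phi n) / 2 * c],
   which contradicts the two energy bounds. *)
have [n [nBp nBq bn]] : exists n, [/\ (nu Bp <= P (phi n) Bp + (al / 2)%:E)%E,
    (nu Bq <= P (phi n) Bq + (be / 2)%:E)%E & 2 * (1 - ln m) / c < b (phi n)].
  have [N0 _ bN] := cvgry_gt b_oo (2 * (1 - ln m) / c).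
  have al20 : 0 < al / 2 by rewrite divr_gt0.
  have be20 : 0 < be / 2 by rewrite divr_gt0.
  have h1 := nuP Bp (open_mball _ _) _ al20.
  have h2 := nuP Bq (open_mball _ _) _ be20.
  have h3 : \forall n \near \oo, (N0 <= n)%N by exact: nbhs_infty_ge.
  have [n [[? ?] N0n]] := filter_ex (filterI (filterI h1 h2) h3).
  by exists n; split => //; apply: bN; exact: leq_trans (phi_ge n).
have mBz : measurable Bz by exact: mB.
have Etrial : (Eb mu k (b (phi n)) (g (phi n)) <=
    (- ln m + b (phi n) / 2 * c)%:E)%E.
  apply: le_trans (g_min (phi n) _ (normalized_indic_admissible mBz muz)) _.
  apply: (Eb_normalized_indic_le (L := L)) => //; exact: ltW.
have : ((-1)%:E + (b (phi n) / 2 * (k p q / 2))%:E *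
    (P (phi n) Bp * P (phi n) Bq) <= (- ln m + b (phi n) / 2 * c)%:E)%E.
  apply: (le_trans _ Etrial); rewrite (PP _).1// [P _ Bq](PP _).1//.
  apply: (Eb_ge (L := L)) => //; first by rewrite divr_ge0.
  exact: le_lt_trans Etrial (ltry _).
move: nBp nBq; rewrite -(fE nu Bp)// -(fE nu Bq)// -(fE (P _) Bp)// -(fE (P _) Bq)//.
rewrite -/al -/be.
set a' := fine (P _ Bp); set b' := fine (P _ Bq).
rewrite -!EFinM -!EFinD !lee_fin => ha hb E_le.
have a2 : al / 2 <= a' by lra.
have b2 : be / 2 <= b' by lra.
have ab : al / 2 * (be / 2) <= a' * b' by apply: ler_pM => //; rewrite divr_ge0// ltW.
have bc : b (phi n) / 2 * (k p q / 2) * (al / 2 * (be / 2)) = b (phi n) * c.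
  by rewrite /c; field.
have bk : 0 <= b (phi n) / 2 * (k p q / 2).
  by rewrite mulr_ge0// divr_ge0// ltW.
have := ler_wpM2l bk ab; rewrite bc => h.
move: bn; rewrite ltr_pdivrMr// => bn.
by lra.
Qed.
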